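(* Let $n\ge1$ be an integer and let $X$ be a Banach space such that $X^*=\ell_1(\Omega_0^n)$ (isometrically), and suppose that there are $x_1^*,\dots,x_n^*\in\ell_1(\Omega_0^n)$ such that, for all $s=1,\dots,n$, the sequence $(e^*_{s,j})_{j\ge1}$ converges to $x_s^*$ in the topology $\sigma(\ell_1(\Omega_0^n),X)$ as $j\to\infty$. Then $X=W_{x_1^*,\dots,x_n^*}$, i.e. $X$ is isometric to $W_{x_1^*,\dots,x_n^*}$.
   Context: All spaces are real. For an integer $n\ge1$ let $$\Omega_0^n=\left\{\left(\tfrac1i,\tfrac1j\right)\in\mathbb R^2: i=1,\dots,n,\ j=1,2,\dots\right\},\qquad \Omega^n=\Omega_0^n\cup\left\{\left(\tfrac1i,0\right)\in\mathbb R^2:i=1,\dots,n\right\},$$ with the Euclidean topology, so that $\Omega^n$ is compact. $C(\Omega^n)$ is the space of real-valued continuous functions on $\Omega^n$ with the supremum norm. $\ell_1(\Omega_0^n)$ is the space of absolutely summable families $z^*=(z^*(i,j))_{1\le i\le n,\,j\ge1}$ (the index $(i,j)$ corresponding to the point $(1/i,1/j)$) with norm $\|z^*\|=\sum_{i=1}^n\sum_{j=1}^\infty|z^*(i,j)|$; its standard basis vectors are denoted $e^*_{i,j}$. The hypothesis $X^*=\ell_1(\Omega_0^n)$ means that a linear isometry of $X^*$ onto $\ell_1(\Omega_0^n)$ is fixed, and $\sigma(\ell_1(\Omega_0^n),X)$ is the corresponding weak$^*$ topology. For $x_1^*,\dots,x_n^*$ in the closed unit ball of $\ell_1(\Omega_0^n)$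 (weak$^*$ limits of the norm-one vectors $e^*_{s,j}$ automatically lie in this ball) define the closed subspace $$W_{x_1^*,\dots,x_n^*}=\left\{f\in C(\Omega^n): f\left(\tfrac1s,0\right)=\sum_{i=1}^n\left(\sum_{j=1}^\infty f\left(\tfrac1i,\tfrac1j\right)x_s^*(i,j)\right)\ \text{for all } s=1,\dots,n\right\}$$ of $C(\Omega^n)$, with the supremum norm. ''Isometric'' means linearly isometric (isometrically isomorphic). *)

(* Defs.v *)
From HB Require Import structures.
From mathcomp Require Import all_boot all_order all_algebra.
From mathcomp Require Import all_classical all_reals all_analysis.

Set Implicit Arguments.
Unset Strict Implicit.
Unset Printing Implicit Defensive.

Import Order.TTheory GRing.Theory Num.Theory.
Import numFieldTopology.Exports numFieldNormedType.Exports.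

Local Open Scope classical_set_scope.
Local Open Scope ring_scope.

Section Dual.
Context {R : realType} (X : normedModType R).

Definition is_dual : {pred X -> R^o} := fun f => `[< linear f /\ continuous f >].

Record dual := Dual { dual_fun :> X -> R^o ; _ : is_dual dual_fun }.

HB.instance Definition _ := [isSub for dual_fun].
HB.instance Definition _ := [Choice of dual by <:].

Let dual_submod_closed : submod_closed is_dual.
Proof.
split.
  apply/asboolP; split; first by move=> k u v; rewrite /= scaler0 addr0.
  by move=> x; exact: cst_continuous.
move=> a f g /asboolP[lf cf] /asboolP[lg cg]; apply/asboolP; split.
  move=> k u v; rewrite !fctE lf lg !scalerDr !scalerA (mulrC k a).
  by rewrite -!addrA; congr (_ + _); rewrite addrCA.
by move=> x; apply: cvgD; [apply: cvgZl_tmp; exact: cf|exact: cg].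
Qed.

HB.instance Definition _ :=
  GRing.isSubmodClosed.Build R (X -> R^o) is_dual dual_submod_closed.
HB.instance Definition _ := [SubChoice_isSubLmodule of dual by <:].

Definition dual_norm (f : dual) : R :=
  sup [set `|f x| | x in [set x : X | `|x| <= 1]].

Lemma dual_linear (f : dual) : linear f.
Proof. by case: f => f /= /asboolP[]. Qed.

Lemma dual_continuous (f : dual) : continuous f.
Proof. by case: f => f /= /asboolP[]. Qed.

HB.instance Definition _ (f : dual) :=
  GRing.isLinear.Build R X R^o _ (dual_fun f) (dual_linear f).

Let has_ubound_dual (f : dual) :
  has_ubound [set `|f x| | x in [set x : X | `|x| <= 1]].
Proof.
have /linear_bounded_continuous/linear_boundedP : continuous (dual_fun f).
  exact: dual_continuous.
move=> /pinfty_ex_gt0[M M0 fM]; exists M => _ [x /= x1 <-].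
by rewrite (le_trans (fM x))// -[leRHS]mulr1 ler_pM2l.
Qed.

Let dual_norm_ub (f : dual) x : `|x| <= 1 -> `|f x| <= dual_norm f.
Proof. by move=> x1; apply: ub_le_sup => //; exists x. Qed.

Let dual_norm_le (f : dual) M :
  (forall x, `|x| <= 1 -> `|f x| <= M) -> dual_norm f <= M.
Proof.
move=> fM; apply: ge_sup; last by move=> _ [x /= x1 <-]; exact: fM.
by exists `|f 0|, 0 => //=; rewrite normr0.
Qed.

Let dual_ler_normD f g : dual_norm (f + g) <= dual_norm f + dual_norm g.
Proof.
apply: dual_norm_le => x x1; rewrite (le_trans (ler_normD _ _))//.
by rewrite lerD// dual_norm_ub.
Qed.

Let dual_normrZ_le (l : R) f : dual_norm (l *: f) <= `|l| * dual_norm f.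
Proof.
apply: dual_norm_le => x x1; rewrite [leLHS]normrM.
by rewrite ler_wpM2l// dual_norm_ub.
Qed.

Let dual_normrZ (l : R) f : dual_norm (l *: f) = `|l| * dual_norm f.
Proof.
apply/eqP; rewrite eq_le dual_normrZ_le/=.
have [->|l0] := eqVneq l 0.
  rewrite normr0 mul0r (le_trans (normr_ge0 ((0 *: f : dual) 0)))//.
  by apply: dual_norm_ub; rewrite normr0.
rewrite -ler_pdivlMl ?normr_gt0// -normfV.
by rewrite (le_trans _ (dual_normrZ_le _ _))// scalerA mulVf// scale1r.
Qed.

Let dual_normr0_eq0 f : dual_norm f = 0 -> f = 0.
Proof.
move=> f0; apply/val_inj/funext => x /=.
have [->|x0] := eqVneq x 0; first exact: raddf0.
have : `|f (`|x|^-1 *: x)| <= dual_norm f.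
  by apply: dual_norm_ub; rewrite normrZ normfV normr_id mulVf// normr_eq0.
rewrite f0 normr_le0 linearZ/= scaler_eq0 invr_eq0 normr_eq0 (negbTE x0).
by move=> /= /eqP.
Qed.

HB.instance Definition _ := Lmodule_isNormed.Build R dual
  dual_ler_normD dual_normrZ dual_normr0_eq0.

End Dual.

Section Ell1.
Context (R : realType) (n : nat).

(* z i j is the coefficient z^*(i+1, j+1); as i ranges over a finite set,
   absolute summability amounts to that of each row. *)
Definition abs_summable : {pred 'I_n -> nat -> R^o} :=
  fun z => `[< forall i, cvgn (series (fun j => `|z i j|)) >].

Record ell1 := Ell1 {
  ell1_fun :> 'I_n -> nat -> R^o ; _ : abs_summable ell1_fun }.

HB.instance Definition _ := [isSub for ell1_fun].
HB.instance Definition _ := [Choice of ell1 by <:].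

Let abs_summable_submod_closed : submod_closed abs_summable.
Proof.
split.
  apply/asboolP => i; rewrite (_ : series _ = cst 0); first exact: is_cvg_cst.
  by apply/funext => k; rewrite seriesEnat/= big1// => j _; rewrite normr0.
move=> a z w /asboolP hz /asboolP hw; apply/asboolP => i.
apply: (@series_le_cvg _ _ (`|a| *: (fun j => `|z i j|) + (fun j => `|w i j|))).
- by [].
- by move=> j; rewrite addr_ge0// mulr_ge0.
- by move=> j; rewrite (le_trans (ler_normD _ _))// normrM.
- by apply: is_cvg_seriesD => //; exact: is_cvg_seriesZ.
Qed.

HB.instance Definition _ := GRing.isSubmodClosed.Build R ('I_n -> nat -> R^o)
  abs_summable abs_summable_submod_closed.
HB.instance Definition _ := [SubChoice_isSubLmodule of ell1 by <:].

Definition ell1_norm (z : ell1) : R :=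
  \sum_(i < n) limn (series (fun j => `|z i j|)).

Lemma ell1_cvg (z : ell1) i : cvgn (series (fun j => `|z i j|)).
Proof. by case: z => z /= /asboolP. Qed.
Arguments ell1_cvg : clear implicits.

Let ell1_ler_normD z w : ell1_norm (z + w) <= ell1_norm z + ell1_norm w.
Proof.
rewrite -big_split/=; apply: ler_sum => i _.
rewrite -(lim_seriesD (ell1_cvg z i) (ell1_cvg w i)).
apply: lim_series_le; first exact: (ell1_cvg (z + w)).
- by apply: is_cvg_seriesD; exact: ell1_cvg.
- by move=> j; exact: ler_normD.
Qed.

Let ell1_normrZ (l : R) z : ell1_norm (l *: z) = `|l| * ell1_norm z.
Proof.
rewrite /ell1_norm mulr_sumr; apply: eq_bigr => i _.
rewrite -[RHS](lim_seriesZ _ (ell1_cvg z i)); congr (limn (series _)).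
by apply/funext => j; rewrite /= normrM.
Qed.

Let ell1_normr0_eq0 z : ell1_norm z = 0 -> z = 0.
Proof.
have nd i : nondecreasing_seq (series (fun j => `|z i j|)).
  by apply: nondecreasing_series => j _ _.
have lim_ge i j : `|z i j| <= limn (series (fun j => `|z i j|)).
  apply: (le_trans _ (nondecreasing_cvgn_le (nd i) (ell1_cvg z i) j.+1)).
  by rewrite seriesEnat/= big_nat_recr//= lerDr sumr_ge0.
move=> /eqP; rewrite psumr_eq0; last first.
  by move=> i _; exact: le_trans (lim_ge i 0%N).
move=> /allP z0; apply/val_inj/funext => i; apply/funext => j /=.
apply/eqP; rewrite -normr_le0 (le_trans (lim_ge i j))//.
by rewrite (eqP (z0 i _))// mem_index_enum.
Qed.

HB.instance Definition _ := Lmodule_isNormed.Build R ell1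
  ell1_ler_normD ell1_normrZ ell1_normr0_eq0.

Definition ell1_delta (s : 'I_n) (k : nat) (i : 'I_n) (j : nat) : R^o :=
  ((i == s) && (j == k))%:R.

Let ell1_deltaP s k : abs_summable (ell1_delta s k).
Proof.
apply/asboolP => i; apply/cvg_ex; exists (series (fun j => `|ell1_delta s k i j|) k.+1).
apply: cvg_near_cst; near=> m.
have km : (k < m)%N by near: m; exists k.+1.
apply/eqP; rewrite eq_sym; apply/eqP.
rewrite !seriesEnat/= (@big_cat_nat _ _ _ k.+1 0 m)//= [X in _ = _ + X]big_nat.
rewrite [X in _ = _ + X]big1 ?addr0// => j /andP[kj _].
by rewrite /ell1_delta gtn_eqF// andbF normr0.
Unshelve. all: by end_near. Qed.

Definition ell1_basis (s : 'I_n) (j : nat) : ell1 := Ell1 (ell1_deltaP s j).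

End Ell1.

Section ContinuousFunctions.
Context (R : realType) (K : topologicalType).

Definition is_continuous : {pred K -> R^o} := fun f => `[< continuous f >].

(* The index cK is what makes the supremum norm below finite, hence a norm. *)
Record Cspace (cK : compact [set: K]) := CSpace {
  Cspace_fun :> K -> R^o ; _ : is_continuous Cspace_fun }.

Context (cK : compact [set: K]).
Local Notation C := (Cspace cK).

HB.instance Definition _ := [isSub for @Cspace_fun cK].
HB.instance Definition _ := [Choice of C by <:].

Let is_continuous_submod_closed : submod_closed is_continuous.
Proof.
split; first by apply/asboolP => x; exact: cst_continuous.
move=> a f g /asboolP cf /asboolP cg; apply/asboolP => x.
by apply: cvgD; [apply: cvgZl_tmp; exact: cf|exact: cg].
Qed.

HB.instance Definition _ := GRing.isSubmodClosed.Build R (K -> R^o)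
  is_continuous is_continuous_submod_closed.
HB.instance Definition _ := [SubChoice_isSubLmodule of C by <:].

Definition Cspace_norm (f : C) : R := sup (range (fun t => `|f t|)).

Lemma Cspace_continuous (f : C) : continuous f.
Proof. by case: f => f /= /asboolP. Qed.

Let Cspace_norm_ge (f : C) t : `|f t| <= Cspace_norm f.
Proof.
apply: ub_le_sup; last by exists t.
have /compact_bounded/pinfty_ex_gt0[M M0 fM] : compact (f @` [set: K]).
  by apply: continuous_compact => //; apply: continuous_subspaceT;
     exact: Cspace_continuous.
by exists M => _ [x _ <-]; apply: fM; exists x.
Qed.

(* 0 <= M is needed because sup set0 = 0, in case K is empty. *)
Let Cspace_norm_le (f : C) M :
  0 <= M -> (forall t, `|f t| <= M) -> Cspace_norm f <= M.
Proof.
move=> M0 fM; rewrite /Cspace_norm.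
have [->|E0] := eqVneq (range (fun t => `|f t|)) set0; first by rewrite sup0.
by apply: ge_sup => [|_ [t _ <-]//]; exact/set0P.
Qed.

Let Cspace_norm_ge0 (f : C) : 0 <= Cspace_norm f.
Proof.
rewrite /Cspace_norm; have [->|] := eqVneq (range (fun t => `|f t|)) set0.
  by rewrite sup0.
by move=> /set0P[_ [t _ _]]; exact: le_trans (Cspace_norm_ge f t).
Qed.

Let Cspace_ler_normD f g : Cspace_norm (f + g) <= Cspace_norm f + Cspace_norm g.
Proof.
apply: Cspace_norm_le => [|t]; first by rewrite addr_ge0 ?Cspace_norm_ge0.
by rewrite (le_trans (ler_normD _ _))// lerD ?Cspace_norm_ge.
Qed.

Let Cspace_normrZ_le (l : R) f : Cspace_norm (l *: f) <= `|l| * Cspace_norm f.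
Proof.
apply: Cspace_norm_le => [|t]; first by rewrite mulr_ge0 ?Cspace_norm_ge0.
by rewrite [leLHS]normrM ler_wpM2l ?Cspace_norm_ge.
Qed.

Let Cspace_normrZ (l : R) f : Cspace_norm (l *: f) = `|l| * Cspace_norm f.
Proof.
apply/eqP; rewrite eq_le Cspace_normrZ_le/=.
have [->|l0] := eqVneq l 0; first by rewrite normr0 mul0r.
rewrite -ler_pdivlMl ?normr_gt0// -normfV.
by rewrite (le_trans _ (Cspace_normrZ_le _ _))// scalerA mulVf// scale1r.
Qed.

Let Cspace_normr0_eq0 f : Cspace_norm f = 0 -> f = 0.
Proof.
move=> f0; apply/val_inj/funext => t /=.
by apply/eqP; rewrite -normr_le0 -f0 Cspace_norm_ge.
Qed.

HB.instance Definition _ := Lmodule_isNormed.Build R C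
  Cspace_ler_normD Cspace_normrZ Cspace_normr0_eq0.

End ContinuousFunctions.

Section Compactness.

Lemma compact_set_type (T : topologicalType) (A : set T) :
  compact A -> compact [set: A].
Proof.
move=> cA F FF _.
have FA : (set_val @ F) A.
  by apply: (@filterS _ F _ setT) => [x _|]; [exact: set_valP|exact: filterT].
have [p [Ap clp]] := cA _ (fmap_proper_filter set_val FF) FA.
exists (exist _ p (mem_set Ap)); split => // B U FB.
case=> _ [[V oV <-] /= Vp sVU].
have : (set_val @ F) (set_val @` B).
  by apply: (@filterS _ F _ B) FB => x Bx; exists x.
move=> /clp /(_ (open_nbhs_nbhs (conj oV Vp))) [_ [[x Bx <-] Vx]].
by exists x; split => //; exact: sVU.
Qed.

Lemma compact_cvg_seq (T : topologicalType) (u : nat -> T) (l : T) :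
  u @ \oo --> l -> compact (range u `|` [set l]).
Proof.
move=> ul F FF FA; have [lF|lF] := pselect (cluster F l).
  by exists l; split => //; right.
have [B [V [FB lV BV]]] : exists B V, [/\ F B, nbhs l V & B `&` V = set0].
  apply: contrapT => H; apply: lF => B V FB lV; apply/set0P/negP => /eqP BV.
  by apply: H; exists B, V.
have [N _ NV] := ul _ lV.
have cI : compact (u @` `I_N) by apply/finite_compact/finite_image/finite_II.
have [|p [[k _ <-] pF]] := cI F FF.
  apply: filterS (filterI FB FA) => y [By [[k _ uk]|yl]].
    exists k => //=; rewrite ltnNge; apply/negP => Nk.
    suff : (B `&` V) y by rewrite BV.
    by split => //; rewrite -uk; exact: NV.
  suff : (B `&` V) y by rewrite BV.
  by split => //; rewrite yl; exact: nbhs_singleton.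
by exists (u k); split => //; left; exists k.
Qed.

End Compactness.

Section Omega.
Context (R : realType) (n : nat).

(* i : 'I_n and j : nat count from 0, hence the successors. *)
Definition Omega0 : set (R * R) :=
  [set (i.+1%:R^-1, j.+1%:R^-1) | i in [set: 'I_n] & j in [set: nat]].

Definition Omega : set (R * R) :=
  Omega0 `|` [set (i.+1%:R^-1, 0) | i in [set: 'I_n]].

Lemma compact_Omega : compact Omega.
Proof.
pose F (i : nat) : set (R * R) := range (fun j : nat => (i.+1%:R^-1, j.+1%:R^-1))
  `|` [set (i.+1%:R^-1, 0)].
rewrite (_ : Omega = \big[setU/set0]_(i < n) F i).
  apply: bigsetU_compact => i _; apply: compact_cvg_seq.
  apply: (@cvg_pair _ _ _ _ (nbhs (i.+1%:R^-1 : R)) (nbhs (0 : R))).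
    exact: cvg_cst.
  exact: cvg_harmonic.
rewrite -(bigcup_mkord n F); apply/seteqP; split => p.
  move=> [[i _ [j _ pE]]|[i _ pE]]; exists i => //=.
    by left; exists j.
  by right.
move=> [i /= ilt [[j _ pE]|pE]].
  by left; exists (Ordinal ilt) => //; exists j.
by right; exists (Ordinal ilt).
Qed.

Lemma Omega0_in (i : 'I_n) (j : nat) : (i.+1%:R^-1, j.+1%:R^-1) \in Omega.
Proof. by apply/mem_set; left; exists i => //; exists j. Qed.

Lemma Omega_limit_in (i : 'I_n) : (i.+1%:R^-1, 0) \in Omega.
Proof. by apply/mem_set; right; exists i. Qed.

(* The points (1/(i+1), 1/(j+1)) and (1/(i+1), 0), as elements of the subspace
   Omega of R * R. *)
Definition Omega_pt (i : 'I_n) (j : nat) : Omega :=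
  exist (fun p => p \in Omega) _ (Omega0_in i j).

Definition Omega_limit (i : 'I_n) : Omega :=
  exist (fun p => p \in Omega) _ (Omega_limit_in i).

Definition C_Omega := Cspace R (compact_set_type compact_Omega).
HB.instance Definition _ := NormedModule.on C_Omega.

Definition W_subspace (x : 'I_n -> ell1 R n) : set C_Omega :=
  [set f | forall s, f (Omega_limit s) =
     \sum_(i < n) limn (series (fun j => f (Omega_pt i j) * x s i j))].

End Omega.

Definition linear_isometry_onto {R : realType} {U V : normedModType R}
    (f : {linear U -> V}) (A : set V) :=
  (forall u, `|f u| = `|u|) /\ range f = A.

(* sigma(E, X), when E is identified with the dual of X through Phi: the
   initial topology for the evaluations z |-> Phi z x, with x in X. *)
Definition weak_star {R : realType} {E X : normedModType R}
    (Phi : E -> dual X) : Type :=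
  initial_topology (fun z => (Phi z : X -> R^o) : {ptws X -> R^o}).

HB.instance Definition _ (R : realType) (E X : normedModType R)
    (Phi : E -> dual X) := Topological.on (weak_star Phi).

Definition weak_star_cvg {R : realType} {E X : normedModType R}
    (Phi : E -> dual X) (u : nat -> E) (l : E) :=
  (fun j => u j : weak_star Phi) @ \oo --> (l : weak_star Phi).

(* Main.v *)
(** Evaluation sends u in X to the function T u on Omega with values
    Phi e_{i,j} u at (1/i, 1/j) and Phi x_s u at (1/s, 0); it is continuous by
    the weak-star hypothesis, and Phi w u = sum_{i,j} w(i,j) (T u)(1/i, 1/j).
    The latter gives T u in W, and T is an isometry by Hahn-Banach. As X is
    complete, the range of T is closed, so it is enough that a functional f on
    C(Omega) vanishing on the range of T vanishes on W. By Riesz, f is given by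
    weights z in ell_1 at the isolated points and c_s at the limit points; on W
    the values at the limit points are themselves sums over the isolated
    points, hence f is the pairing with w = z + sum_s c_s x_s there. Vanishing
    on T X means Phi w = 0, that is w = 0. *)

Require Import Defs.
From HB Require Import structures.
From mathcomp Require Import all_boot all_order all_algebra.
From mathcomp Require Import all_classical all_reals all_analysis.
From mathcomp Require Import ring.

Set Implicit Arguments.
Unset Strict Implicit.
Unset Printing Implicit Defensive.

Import Order.TTheory GRing.Theory Num.Theory.
Import numFieldTopology.Exports numFieldNormedType.Exports.

Local Open Scope classical_set_scope.
Local Open Scope ring_scope.

(** * Hahn-Banach *)

(** Homogeneity is asked only as an inequality, which is easier to check for infima; scaling back by
    the inverse recovers equality. *)
Definition sublinear (R : realType) (V : lmodType R) (q : V -> R) :=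
  (forall u v, q (u + v) <= q u + q v) /\
  (forall a v, 0 <= a -> q (a *: v) <= a * q v).

Section Sublinear.
Context (R : realType) (V : lmodType R).
Implicit Types (p q : V -> R) (u v w : V).

Lemma sublinear0 q : sublinear q -> q 0 = 0.
Proof.
move=> [qD qZ]; apply/eqP; rewrite eq_le; apply/andP; split.
  by have := qZ 0 0 (lexx 0); rewrite scaler0 mul0r.
by have := qD 0 0; rewrite addr0 -[X in X <= _]addr0 lerD2l.
Qed.

Lemma sublinearZ q a v : sublinear q -> 0 <= a -> q (a *: v) = a * q v.
Proof.
move=> qs a0; apply/eqP; rewrite eq_le qs.2//=.
have [->|an0] := eqVneq a 0; first by rewrite scale0r sublinear0// mul0r.
rewrite -ler_pdivlMl ?lt_def ?an0//.
by rewrite -[in leLHS](scale1r v) -(mulVf an0) -scalerA qs.2// invr_ge0.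
Qed.

Lemma sublinear_ge q v : sublinear q -> - q (- v) <= q v.
Proof.
move=> qs; rewrite -subr_ge0 opprK -(sublinear0 qs) -(subrr v).
exact: (qs.1 v (- v)).
Qed.

(** Common source of the sublinear functions below (shifts, infima of chains, distances): it
    suffices that the sets [S v] are stable under sums and nonnegative scalings up to decreasing the
    value. *)
Lemma sublinear_inf (S : V -> set R) :
  (forall v, S v !=set0) -> (forall v, has_lbound (S v)) ->
  (forall u v a b, S u a -> S v b -> exists2 c, S (u + v) c & c <= a + b) ->
  (forall t v a, 0 <= t -> S v a -> exists2 c, S (t *: v) c & c <= t * a) ->
  sublinear (fun v => inf (S v)).
Proof.
move=> S0 Slb SD SZ; split => [u v|t v t0].
  rewrite -lerBlDr; apply: lb_le_inf => // a Sa; rewrite lerBlDr -lerBlDl.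
  apply: lb_le_inf => // b Sb; rewrite lerBlDl.
  have [c Sc cab] := SD _ _ _ _ Sa Sb.
  by apply: le_trans cab; exact: ge_inf.
(* Division by [t] is impossible at 0, but there the scaling hypothesis directly gives an element of
   [S (0 *: v)] that is at most 0. *)
have [->|tn0] := eqVneq t 0.
  have [a Sa] := S0 v; have [c Sc] := SZ _ _ _ (lexx 0) Sa.
  by rewrite !mul0r; apply: le_trans; exact: ge_inf.
have tgt0 : 0 < t by rewrite lt_def tn0.
rewrite -ler_pdivrMl//; apply: lb_le_inf => // a Sa; rewrite ler_pdivrMl//.
by have [c Sc] := SZ _ _ _ t0 Sa; apply: le_trans; exact: ge_inf.
Qed.

(* The largest sublinear function below [q] taking a value at most [- q w] at
   [- w]: it forces a minimal sublinear function to be odd. *)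
Definition sublinear_shift q w v : R :=
  inf [set q (v + t *: w) - t * q w | t in [set t : R | 0 <= t]].

(** Subadditivity gives [t * q w = q (t *: w) <= q (v + t *: w) + q (- v)], a bound uniform in
    [t]. *)
Lemma sublinear_shift_has_lbound q w v : sublinear q ->
  has_lbound [set q (v + t *: w) - t * q w | t in [set t : R | 0 <= t]].
Proof.
move=> qs; exists (- q (- v)) => _ [t /= t0 <-].
rewrite lerBrDr addrC lerBlDr (le_trans _ (qs.1 _ _))//.
by rewrite addrAC subrr add0r sublinearZ.
Qed.

Lemma sublinear_shiftP q w : sublinear q -> sublinear (sublinear_shift q w).
Proof.
move=> qs; apply: sublinear_inf => [v|v|u v _ _ [s /= s0 <-] [t /= t0 <-]|].
- by exists (q (v + 0 *: w) - 0 * q w), 0 => /=.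
- exact: sublinear_shift_has_lbound.
- exists (q (u + v + (s + t) *: w) - (s + t) * q w).
    by exists (s + t) => //=; exact: addr_ge0.
  rewrite mulrDl opprD addrACA lerD2r (le_trans _ (qs.1 _ _))//.
  by rewrite scalerDl addrACA.
- move=> s v _ s0 [t /= t0 <-].
  exists (q (s *: v + (s * t) *: w) - (s * t) * q w).
    by exists (s * t) => //=; exact: mulr_ge0.
  by rewrite -scalerA -scalerDr sublinearZ// mulrBr mulrA.
Qed.

Lemma sublinear_shift_le q w v : sublinear q -> sublinear_shift q w v <= q v.
Proof.
move=> qs; apply: ge_inf; first exact: sublinear_shift_has_lbound.
by exists 0 => //=; rewrite scale0r addr0 mul0r subr0.
Qed.

Lemma sublinear_shiftN q w : sublinear q -> sublinear_shift q w (- w) <= - q w.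
Proof.
move=> qs; apply: ge_inf; first exact: sublinear_shift_has_lbound.
by exists 1 => //=; rewrite scale1r addNr sublinear0// mul1r sub0r.
Qed.

(** Zorn's lemma below [p]: the pointwise infimum of a nonempty chain is again sublinear, and [p]
    itself bounds the empty chain. *)
Lemma minimal_sublinear p : sublinear p ->
  exists q, [/\ sublinear q, forall v, q v <= p v &
    forall r, sublinear r -> (forall v, r v <= q v) -> r = q].
Proof.
move=> ps.
pose T := {q : V -> R | sublinear q /\ forall v, q v <= p v}.
(* The order is reversed, so that maximal elements for [le] are minimal sublinear functions. *)
pose le (q r : T) : bool := `[< forall v, sval r v <= sval q v >].
have lexT (q : T) : le q q by apply/asboolP.
have le_transT (q r s : T) : le q r -> le r s -> le q s.
  move=> /asboolP qr /asboolP rs; apply/asboolP => v.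
  exact: le_trans (rs v) (qr v).
have le_antiT (q r : T) : le q r -> le r q -> q = r.
  move=> /asboolP qr /asboolP rq; apply: eq_sig_hprop.
    by move=> ? ? ?; exact: Prop_irrelevance.
  apply/funext => v.
  by apply/eqP; rewrite eq_le qr rq.
have [A totA|[q [qs qp]] qmin] := Zorn lexT le_transT le_antiT; last first.
  exists q; split => // r rs rq.
  have rP : sublinear r /\ forall v, r v <= p v.
    by split => // v; exact: le_trans (rq v) (qp v).
  have /qmin/(congr1 sval)/= -> // : le (exist _ q (conj qs qp)) (exist _ r rP).
  by apply/asboolP.
have [A0|/set0P[q0 Aq0]] := eqVneq A set0.
  by exists (exist _ p (conj ps (fun v => lexx (p v)))) => q; rewrite A0.
pose S v : set R := [set sval q v | q in A].
have S0 v : S v !=set0 by exists (sval q0 v), q0.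
have Slb v : has_lbound (S v).
  (* All members of the chain share this bound, since [- p (- v) <= - q (- v) <= q v]. *)
  exists (- p (- v)) => _ [[q [qs qp]] _ <-] /=.
  by rewrite (le_trans _ (sublinear_ge v qs))// lerN2.
have infs : sublinear (fun v => inf (S v)).
  apply: sublinear_inf => // [u v _ _ [q Aq <-] [r Ar <-]|t v _ t0 [q Aq <-]].
    (* The smaller of [q] and [r], evaluated at [u + v], is at most [q u + r v]; this is where the
       chain must be total. *)
    have [/asboolP qr|/asboolP rq] := totA _ _ Aq Ar.
      exists (sval r (u + v)); first by exists r.
      case: (r) qr => r' [rs rp]/= qr.
      by rewrite (le_trans (rs.1 _ _))// lerD2r.
    exists (sval q (u + v)); first by exists q.
    by case: (q) rq => q' [qs qp]/= rq; rewrite (le_trans (qs.1 _ _))// lerD2l.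
  exists (sval q (t *: v)); first by exists q.
  by case: (q) => q' [qs qp]/=; exact: qs.2.
have infp v : inf (S v) <= p v.
  apply: (@le_trans _ _ (sval q0 v)); first by apply: ge_inf => //; exists q0.
  by case: (q0) => q' [].
exists (exist _ (fun v => inf (S v)) (conj infs infp) : T) => q Aq.
by apply/asboolP => v /=; apply: ge_inf => //; exists q.
Qed.

(** Minimality identifies [q] with its shifts, so [q] is odd. Then [q u <= q (u + v) + q (- v)] is
    the missing half of additivity, and oddness extends homogeneity to negative scalars. *)
Lemma minimal_sublinear_linear q : sublinear q ->
  (forall r, sublinear r -> (forall v, r v <= q v) -> r = q) ->
  linear (q : V -> R^o).
Proof.
move=> qs qmin.
have qN v : q (- v) = - q v.
  apply/eqP; rewrite eq_le; apply/andP; split; last first.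
    by rewrite -[leRHS]opprK lerN2; exact: sublinear_ge.
  rewrite -{1}(qmin _ (sublinear_shiftP v qs)); first exact: sublinear_shiftN.
  by move=> u; exact: sublinear_shift_le.
have qD u v : q (u + v) = q u + q v.
  apply/eqP; rewrite eq_le qs.1/=.
  by rewrite -lerBrDr -qN (le_trans _ (qs.1 _ _))// addrK.
move=> a u v; rewrite qD; congr (_ + _).
have [a0|/ltW a0] := leP 0 a; first exact: sublinearZ.
by rewrite -[a]opprK scaleNr qN sublinearZ ?oppr_ge0// scaleNr.
Qed.

(* Applied to [sublinear_shift p w], minimality gives [f (- w) <= - p w]. *)
Theorem Hahn_Banach p w : sublinear p ->
  exists f : {linear V -> R^o}, (forall v, f v <= p v) /\ f w = p w.
Proof.
move=> ps.
have [q [qs qp qmin]] := minimal_sublinear (sublinear_shiftP w ps).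
pose L := GRing.isLinear.Build _ _ _ _ _ (minimal_sublinear_linear qs qmin).
pose f : {linear V -> R^o} := HB.pack (q : V -> R^o) L.
have fp v : f v <= p v by exact: le_trans (qp v) (sublinear_shift_le w v ps).
exists f; split => //; apply/eqP; rewrite eq_le fp/=.
rewrite -lerN2 -(linearN f); exact: le_trans (qp _) (sublinear_shiftN w ps).
Qed.

End Sublinear.

Lemma normr_sublinear (R : realType) (V : normedModType R) :
  sublinear (fun v : V => `|v|).
Proof.
by split=> [u v|a v a0]; [exact: ler_normD|rewrite normrZ ger0_norm].
Qed.

(** * Distance to the range of a linear map *)

Definition dist_range (R : realType) (U : lmodType R) (V : normedModType R)
  (T : U -> V) (v : V) : R := inf (range (fun u => `|v - T u|)).

Section DistRange.
Context (R : realType) (U : lmodType R) (V : normedModType R).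
Variable T : {linear U -> V}.

Lemma dist_range_le u v : dist_range T v <= `|v - T u|.
Proof. by apply: ge_inf; [exists 0 => _ [w _ <-]|exists u]. Qed.

(** Lets the distance serve as the dominating function in Hahn-Banach, which produces functionals
    vanishing on the range. *)
Lemma dist_range_sublinear : sublinear (dist_range T).
Proof.
apply: sublinear_inf => [v|v|v w _ _ [u _ <-] [u' _ <-]|a v _ a0 [u _ <-]].
- by exists `|v - T 0|, 0.
- by exists 0 => _ [u _ <-].
- exists `|v + w - T (u + u')|; first by exists (u + u').
  by rewrite raddfD opprD addrACA ler_normD.
- exists `|a *: v - T (a *: u)|; first by exists (a *: u).
  by rewrite linearZ -scalerBr normrZ ger0_norm.
Qed.

Lemma dist_range0 v e : dist_range T v = 0 -> 0 < e ->
  exists u, `|v - T u| < e.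
Proof.
move=> v0 e0; have rinf : has_inf (range (fun u => `|v - T u|)).
  by split; [exists `|v - T 0|, 0|exists 0 => _ [u _ <-]].
have [_ [u _ <-]] := inf_adherent e0 rinf.
by rewrite -/(dist_range T v) v0 add0r; exists u.
Qed.

End DistRange.

(** If [T (u k)] approaches [v], it is Cauchy; the isometry carries this back to [u], and
    completeness of [U] gives a limit, whose image is [v]. *)
Lemma isometry_range_closed (R : realType) (U : completeNormedModType R)
    (V : normedModType R) (T : {linear U -> V}) v :
  (forall u, `|T u| = `|u|) -> dist_range T v = 0 -> range T v.
Proof.
move=> Tiso v0.
have /choice[u uP] k : exists u, `|v - T u| < k.+1%:R^-1.
  by apply: dist_range0 => //; rewrite invr_gt0.
have uc : cvgn u.
  apply/cauchy_cvgP/cauchy_exP => e e0.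
  have [N _ uN] := near_infty_natSinv_lt (PosNum (divr_gt0 e0 (ltr0n R 2))).
  exists (u N); exists N => // k Nk; rewrite -ball_normE/= -Tiso raddfB.
  rewrite -(subrKA v) (le_lt_trans (ler_normD _ _))// (splitr e) distrC.
  by rewrite ltrD// (lt_trans (uP _))//; [apply: uN => /=|exact: uN].
exists (limn u) => //; apply/eqP; rewrite -subr_eq0 -normr_le0.
apply/ler_addgt0Pr => e e0; rewrite add0r.
have e20 : 0 < e / 2 by rewrite divr_gt0.
near \oo => k.
rewrite -(subrKA (T (u k))) -raddfB (le_trans (ler_normD _ _))//.
rewrite Tiso (splitr e).
rewrite lerD// ltW//.
  by near: k; move: uc => /cvgrPdist_lt/(_ _ e20).
rewrite distrC (lt_trans (uP _))//.
by near: k; exact: near_infty_natSinv_lt (PosNum e20).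
Unshelve. all: by end_near. Qed.

(** * The space Omega *)

Lemma near_dist_continuous (R : realType) (K : topologicalType) (g : K -> R^o)
    (t : K) :
  (forall e, 0 < e -> \forall t' \near t, `|g t - g t'| < e) ->
  {for t, continuous g}.
Proof. by move=> gt; apply/cvgrPdist_lt. Qed.

(** The bound is the gap between 1/(b+1) and 1/(b+2). Gaps between consecutive reciprocals shrink as
    the index grows, so reciprocals larger than 1/(b+1) are at least as far away. *)
Lemma invr_succ_isolated (R : realType) (a b : nat) :
  `|a.+1%:R^-1 - b.+1%:R^-1 : R| < (b.+1%:R * b.+2%:R)^-1 -> a = b.
Proof.
have gap (c d : nat) : (c < d)%N ->
    (c.+1%:R * c.+2%:R)^-1 <= c.+1%:R^-1 - d.+1%:R^-1 :> R.
  move=> cd; rewrite (_ : _^-1 = c.+1%:R^-1 - c.+2%:R^-1).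
    by rewrite lerD2l lerN2 lef_pV2 ?posrE ?ler_nat.
  by rewrite -[c.+2%:R]natr1; field; rewrite nat1r natr1 !pnatr_eq0.
case: (ltngtP a b) => // [ab|ba]; last first.
  rewrite ltNge distrC (le_trans (gap _ _ ba))//.
  by rewrite ler_norm.
rewrite ltNge (le_trans _ (ler_norm _))// (le_trans _ (gap _ _ ab))//.
rewrite lef_pV2 ?posrE ?mulr_gt0 ?ltr0n//.
by rewrite -!natrM ler_nat; apply: leq_mul; rewrite !ltnS ltnW.
Qed.

Section OmegaTopology.
Context (R : realType) (n : nat).
Implicit Types (i : 'I_n) (j : nat) (t : @Omega R n).

Lemma OmegaP t :
  (exists i j, t = Omega_pt R i j) \/ exists i, t = Omega_limit R i.
Proof.
have [[i _ [j _ ij]]|[i _ ij]] := set_valP t; [left|right]; exists i.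
  by exists j; apply: val_inj.
exact: val_inj.
Qed.

Lemma Omega_pt_inj i j i' j' :
  Omega_pt R i j = Omega_pt R i' j' -> i = i' /\ j = j'.
Proof.
move=> /(congr1 val)/= [/invr_inj/eqP ii' /invr_inj/eqP jj'].
move: ii' jj'; rewrite !eqr_nat !eqSS => /eqP ii' /eqP jj'.
by split => //; exact: val_inj.
Qed.

Lemma Omega_limit_inj i i' : Omega_limit R i = Omega_limit R i' -> i = i'.
Proof.
move=> /(congr1 val)/= [/invr_inj/eqP]; rewrite eqr_nat eqSS => /eqP.
exact: val_inj.
Qed.

Lemma Omega_pt_neq_limit i j i' : Omega_pt R i j <> Omega_limit R i'.
Proof. by move=> /(congr1 val)/= [_ /eqP]; rewrite invr_eq0 pnatr_eq0. Qed.

Lemma near_Omega t (e : R) : 0 < e ->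
  \forall t' \near t,
    `|(val t').1 - (val t).1| < e /\ `|(val t').2 - (val t).2| < e.
Proof.
move=> e0.
have te : nbhs (set_val t)
    [set p : R * R | `|p.1 - (val t).1| < e /\ `|p.2 - (val t).2| < e].
  exists (ball (val t).1 e, ball (val t).2 e).
    by split; exact: nbhsx_ballx.
  by case=> p q [/= ? ?]; split; rewrite distrC.
have := @initial_continuous (@Omega R n) (R * R)%type set_val t.
by move=> /(_ _ te).
Qed.

Lemma near_Omega_pt i j : \forall t \near Omega_pt R i j, t = Omega_pt R i j.
Proof.
(* The first bound fixes the row, the second fixes [j] among the isolated points, and the third
   keeps away from second coordinate 0. *)
pose e : R := Num.min (i.+1%:R * i.+2%:R)^-1
  (Num.min (j.+1%:R * j.+2%:R)^-1 j.+1%:R^-1).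
have e0 : 0 < e by rewrite /e !lt_min !invr_gt0 ?mulr_gt0 ?ltr0n.
apply: filterS (near_Omega (Omega_pt R i j) e0) => t.
have [[i' [j' ->]]|[i' ->]] := OmegaP t => /=; rewrite /e !lt_min.
  move=> [/andP[/invr_succ_isolated ii' _] /and3P[_ /invr_succ_isolated -> _]].
  by congr Omega_pt; exact: val_inj.
by move=> [_ /and3P[_ _]]; rewrite sub0r normrN ger0_norm// ltxx.
Qed.

Lemma near_Omega_limit i N : \forall t \near Omega_limit R i,
  t = Omega_limit R i \/ exists2 j, (N <= j)%N & t = Omega_pt R i j.
Proof.
(* The first bound fixes the row; the second forces 1/(j'+1) < 1/(N+1), which leaves a tail of that
   row. *)
pose e : R := Num.min (i.+1%:R * i.+2%:R)^-1 N.+1%:R^-1.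
have e0 : 0 < e by rewrite /e !lt_min !invr_gt0 ?mulr_gt0 ?ltr0n.
apply: filterS (near_Omega (Omega_limit R i) e0) => t.
have [[i' [j' ->]]|[i' ->]] := OmegaP t => /=; rewrite /e !lt_min; last first.
  by move=> [/andP[/invr_succ_isolated/val_inj -> _] _]; left.
move=> [/andP[/invr_succ_isolated/val_inj -> _] /andP[_ jN]]; right.
exists j' => //; move: jN; rewrite subr0 ger0_norm// ltf_pV2 ?posrE ?ltr0n//.
by rewrite ltr_nat => /ltnW.
Qed.

Lemma Omega_pt_cvg i : Omega_pt R i j @[j --> \oo] --> Omega_limit R i.
Proof.
have valc : (i.+1%:R^-1 : R, j.+1%:R^-1 : R) @[j --> \oo] -->
    (i.+1%:R^-1 : R, 0 : R).
  apply: (@cvg_pair _ _ _ _ (nbhs (i.+1%:R^-1 : R)) (nbhs (0 : R))).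
    exact: cvg_cst.
  exact: cvg_harmonic.
move=> U [_ [[W oW <-] /= Wi WU]].
have /valc : nbhs (i.+1%:R^-1 : R, 0 : R) W by exact: open_nbhs_nbhs.
by move=> [N _ NW]; exists N => // j Nj; apply: WU; exact: NW.
Qed.

(** Each point of Omega has a unique description, so the values can be prescribed. Continuity is
    automatic at the isolated points, and at the limit points it is the convergence of [a i] to
    [l i]. *)
Lemma exists_C_Omega (a : 'I_n -> nat -> R^o) (l : 'I_n -> R^o) :
  (forall i, a i @ \oo --> l i) -> exists g : C_Omega R n,
    (forall i j, g (Omega_pt R i j) = a i j) /\
    (forall i, g (Omega_limit R i) = l i).
Proof.
move=> al.
have /choice[g gP] t : exists y : R^o,
    (forall i j, t = Omega_pt R i j -> y = a i j) /\
    (forall i, t = Omega_limit R i -> y = l i).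
  have [[i [j ->]]|[i ->]] := OmegaP t.
    exists (a i j); split=> [i' j' /Omega_pt_inj[-> ->]//|i'].
    by move/Omega_pt_neq_limit.
  exists (l i); split=> [i' j' /esym/Omega_pt_neq_limit//|i'].
  by move=> /Omega_limit_inj ->.
have gpt i j : g (Omega_pt R i j) = a i j by exact: (gP _).1.
have glim i : g (Omega_limit R i) = l i by exact: (gP _).2.
have gc : continuous g.
  move=> t; apply: near_dist_continuous => e e0.
  have [[i [j ->]]|[i ->]] := OmegaP t.
    have := near_Omega_pt i j; apply: filterS => t' ->.
    by rewrite subrr normr0.
  have /cvgrPdist_lt/(_ _ e0)[N _ aN] := al i.
  have := near_Omega_limit i N; apply: filterS => t' [->|[j Nj ->]].
    by rewrite subrr normr0.
  by rewrite gpt glim; exact: aN.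
by exists (CSpace _ (introT (asboolP (continuous g)) gc)).
Qed.

End OmegaTopology.

(** * The supremum norm, and its computation on the isolated points of Omega *)

Section CspaceNorm.
Context (R : realType) (K : topologicalType) (cK : compact [set: K]).
Implicit Types f : Cspace R cK.

Lemma Cspace_normE f : `|f| = sup (range (fun t => `|f t|)).
Proof. by []. Qed.

Lemma Cspace_norm_ge f t : `|f t| <= `|f|.
Proof.
rewrite Cspace_normE; apply: ub_le_sup; last by exists t.
have /compact_bounded/pinfty_ex_gt0[M M0 fM] : compact (f @` [set: K]).
  apply: continuous_compact => //; apply: continuous_subspaceT.
  exact: Cspace_continuous.
by exists M => _ [x _ <-]; apply: fM; exists x.
Qed.

Lemma Cspace_norm_le f (M : R) : 0 <= M -> (forall t, `|f t| <= M) -> `|f| <= M.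
Proof.
move=> M0 fM; rewrite Cspace_normE.
have [->|E0] := eqVneq (range (fun t => `|f t|)) set0; first by rewrite sup0.
by apply: ge_sup => [|_ [t _ <-]//]; exact/set0P.
Qed.

End CspaceNorm.

Section COmega.
Context (R : realType) (n : nat).
Implicit Types f g : C_Omega R n.

Lemma C_Omega_cvg f i : f (Omega_pt R i j) @[j --> \oo] --> f (Omega_limit R i).
Proof.
move=> U fU; apply: (@Omega_pt_cvg R n i (f @^-1` U)).
exact: (@Cspace_continuous _ _ _ f (Omega_limit R i) U fU).
Qed.

(** The isolated points are dense: each value at a limit point is the limit of the values along its
    row. *)
Lemma C_Omega_norm_le f (M : R) : 0 <= M ->
  (forall i j, `|f (Omega_pt R i j)| <= M) -> `|f| <= M.
Proof.
move=> M0 fM; apply: Cspace_norm_le => // t.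
have [[i [j ->//]]|[i ->]] := OmegaP t.
have /cvg_norm fi := @C_Omega_cvg f i.
rewrite -(cvg_lim _ fi)//; apply: limr_le.
  by apply/cvg_ex; eexists; exact: fi.
by apply: nearW => j.
Qed.

Lemma C_Omega_ext f g :
  (forall i j, f (Omega_pt R i j) = g (Omega_pt R i j)) -> f = g.
Proof.
move=> fg; apply/eqP; rewrite -subr_eq0 -normr_le0.
apply: C_Omega_norm_le => // i j.
by rewrite -[X in `|X|]/(f _ - g _) fg subrr normr0.
Qed.

End COmega.

(** * Sequences in ell_1 *)

Lemma linear_bound_continuous (R : realType) (V W : normedModType R)
    (f : {linear V -> W}) (C : R) :
  (forall v, `|f v| <= C * `|v|) -> continuous f.
Proof.
move=> fC; apply: bounded_linear_continuous; apply/linear_boundedP.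
have := nbhs_pinfty_ge (num_real C); apply: filterS => r Cr v.
by rewrite (le_trans (fC v))// ler_wpM2r.
Qed.

Lemma sum_eq_index (R : pzRingType) (u : nat -> R) (j N : nat) :
  \sum_(0 <= l < N) u l * (j == l)%:R = if (j < N)%N then u j else 0.
Proof.
case: ltnP => jN.
  rewrite (bigD1_seq j) ?mem_index_iota ?iota_uniq//= big1 => [|l lj].
    by rewrite eqxx mulr1 addr0.
  by rewrite eq_sym (negbTE lj) mulr0.
rewrite big_nat big1// => l /andP[_ lN].
by rewrite gtn_eqF ?mulr0 ?(leq_trans lN).
Qed.

Section Ell1.
Context (R : realType) (n : nat).
Implicit Types (z w : ell1 R n) (i : 'I_n) (j N : nat).

Lemma ell1_normE z : `|z| = \sum_(i < n) limn (series (fun j => `|z i j|)).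
Proof. by []. Qed.

Lemma ell1_row_cvg z i : series (fun j => `|z i j|) @ \oo -->
  limn (series (fun j => `|z i j|)).
Proof. exact: (@ell1_cvg R n z i). Qed.

Lemma ell1_row_ge z i N :
  series (fun j => `|z i j|) N <= limn (series (fun j => `|z i j|)).
Proof.
apply: nondecreasing_cvgn_le; last exact: ell1_row_cvg.
exact: nondecreasing_series.
Qed.

Lemma ell1_row_le z i (M : R) : (forall N, series (fun j => `|z i j|) N <= M) ->
  limn (series (fun j => `|z i j|)) <= M.
Proof.
by move=> zM; apply: limr_le; [exact: ell1_row_cvg|exact: nearW].
Qed.

Lemma ell1_addE z w i j : (z + w) i j = z i j + w i j. Proof. by []. Qed.

Lemma ell1_scaleE (a : R) z i j : (a *: z) i j = a * z i j. Proof. by []. Qed.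

Lemma ell1_subE z w i j : (z - w) i j = z i j - w i j. Proof. by []. Qed.

Lemma ell1_sumE (I : Type) (r : seq I) (F : I -> ell1 R n) i j :
  (\sum_(k <- r) F k) i j = \sum_(k <- r) F k i j.
Proof.
by elim/big_rec2: _ => // k _ z _ <-.
Qed.

Lemma ell1_basis_norm_le i j : `|ell1_basis R i j| <= 1.
Proof.
rewrite ell1_normE (bigD1 i)//= big1 ?addr0 => [|k ki].
  apply: (@ell1_row_le (ell1_basis R i j) i) => N; rewrite seriesEnat/=.
  under eq_bigr do rewrite /ell1_delta eqxx/= normr_nat.
  (* The partial sum counts the occurrences of [j] among the indices below [N], hence is at most
     1. *)
  rewrite -natr_sum (ler_nat _ _ 1).
  rewrite (_ : \sum_(_ <= _ < _) _ = count_mem j (index_iota 0 N))%N.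
    by rewrite count_uniq_mem ?iota_uniq ?leq_b1.
  by rewrite -sum1_count [RHS]big_mkcond.
apply/eqP; rewrite eq_le; apply/andP; split.
  apply: (@ell1_row_le (ell1_basis R i j) k) => N.
  by rewrite seriesEnat/= big1// => l _; rewrite /ell1_delta (negbTE ki) normr0.
apply: (le_trans _ (@ell1_row_ge (ell1_basis R i j) k 0)).
by rewrite seriesEnat/= big_nil.
Qed.

(** Written as a finite combination of basis vectors, rather than as a cut-off family, so that
    linear maps can be applied termwise. *)
Definition ell1_trunc z N : ell1 R n :=
  \sum_(i < n) \sum_(0 <= j < N) (z i j : R) *: ell1_basis R i j.

Lemma ell1_truncE z N i j : ell1_trunc z N i j = if (j < N)%N then z i j else 0.
Proof.
have termE k l : (z k l *: ell1_basis R k l) i j =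
  z k l * ((i == k) && (j == l))%:R by [].
rewrite ell1_sumE (bigD1 i)//= [X in _ + X]big1 => [|k ki]; last first.
  by rewrite ell1_sumE big1// => l _; rewrite termE eq_sym (negbTE ki) mulr0.
rewrite addr0 ell1_sumE; under eq_bigr do rewrite termE eqxx/=.
exact: sum_eq_index.
Qed.

(** The norm of the difference is controlled by [d N], the sum of the finitely many row tails, each
    of which tends to 0. *)
Lemma ell1_trunc_cvg z : ell1_trunc z N @[N --> \oo] --> z.
Proof.
pose d N := \sum_(i < n)
  (limn (series (fun j => `|z i j|)) - series (fun j => `|z i j|) N).
have d0 : d N @[N --> \oo] --> (0 : R).
  rewrite -[0](_ : \sum_(i < n) 0 = 0); last by rewrite big1.
  apply: cvg_big => [|i _]; first exact: add_continuous.
  rewrite -(subrr (limn (series (fun j => `|z i j|)))).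
  by apply: cvgB; [exact: cvg_cst|exact: ell1_row_cvg].
apply/cvgrPdist_le => e e0.
move/cvgrPdist_le : d0 => /(_ _ e0); apply: filterS => N.
rewrite sub0r normrN => dN; rewrite (le_trans _ (le_trans (ler_norm _) dN))//.
rewrite ell1_normE; apply: ler_sum => i _; apply: ell1_row_le => M.
(* Passing to [maxn M N] terms makes the partial sum long enough to be split at [N]. *)
rewrite lerBrDr (le_trans _ (ell1_row_ge z i (maxn M N)))//.
pose tl j : R := if (j < N)%N then 0 else `|z i j|.
rewrite (_ : (fun j => _) = tl); last first.
  apply/funext => j; rewrite /tl ell1_subE ell1_truncE.
  by case: ltnP; rewrite ?subrr ?subr0 ?normr0.
apply: (@le_trans _ _ (series tl (maxn M N) + series (fun j => `|z i j|) N)).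
  rewrite lerD2r; apply: nondecreasing_series (leq_maxl _ _) => j _ _.
  by rewrite /tl; case: ifP.
rewrite !seriesEnat/= addrC !(@big_cat_nat _ _ _ N 0 (maxn M N)) ?leq_maxr//=.
rewrite lerD2l big_nat big1 ?add0r => [|j /andP[_ jN]]; last by rewrite /tl jN.
rewrite big_nat [leRHS]big_nat; apply: ler_sum => j /andP[Nj _].
by rewrite /tl ltnNge Nj.
Qed.

(** The duality between bounded families and ell_1; boundedness of [a] makes the row series
    converge, so that [limn] is a genuine sum. *)
Definition ell1_pairing (a : 'I_n -> nat -> R) z : R :=
  \sum_(i < n) limn (series (fun j => a i j * z i j)).

Lemma ell1_pairing_cvg (a : 'I_n -> nat -> R) (M : R) z i :
  (forall i j, `|a i j| <= M) -> cvgn (series (fun j => a i j * z i j)).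
Proof.
move=> aM; apply: normed_cvg.
apply: (@series_le_cvg _ _ (M *: (fun j => `|z i j|))) => [j|j|j|].
- exact: normr_ge0.
- by rewrite mulr_ge0// (le_trans _ (aM i j)).
- by rewrite [leLHS]normrM ler_wpM2r.
- by apply: is_cvg_seriesZ; exact: ell1_row_cvg.
Qed.

(** On truncations of [z] the functional is a finite sum, and continuity passes to the limit. *)
Lemma ell1_linear_pairing (g : {linear ell1 R n -> R^o}) z : continuous g ->
  g z = ell1_pairing (fun i j => g (ell1_basis R i j)) z.
Proof.
move=> gc.
have [C C0 gC] : exists2 C : R, 0 < C & forall w, `|g w| <= C * `|w|.
  have /linear_bounded_continuous/linear_boundedP := gc.
  by move=> /pinfty_ex_gt0[C C0 gC]; exists C.
have gbasis i j : `|g (ell1_basis R i j)| <= C.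
  by rewrite (le_trans (gC _))// ler_piMr ?ell1_basis_norm_le// ltW.
have gz : g (ell1_trunc z N) @[N --> \oo] --> g z.
  exact: (continuous_cvg _ (gc z) (@ell1_trunc_cvg z)).
rewrite -(cvg_lim _ gz)//; apply: cvg_lim => //.
under eq_fun do rewrite /ell1_trunc linear_sum.
apply: cvg_big => [|i _]; first exact: add_continuous.
rewrite [X in X @ _](_ : _ =
    series (fun j => g (ell1_basis R i j) * z i j)).
  exact: (@ell1_pairing_cvg _ _ z i gbasis).
apply/funext => N; rewrite seriesEnat/= linear_sum.
by apply: eq_bigr => j _; rewrite linearZ/= mulrC.
Qed.

Lemma ell1_pairing_linear (a : 'I_n -> nat -> R) (M : R) :
  (forall i j, `|a i j| <= M) -> linear (ell1_pairing a : ell1 R n -> R^o).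
Proof.
move=> aM k z w; rewrite scaler_sumr -big_split/=; apply: eq_bigr => i _.
have zc := @ell1_pairing_cvg _ _ z i aM.
have wc := @ell1_pairing_cvg _ _ w i aM.
rewrite [X in _ = X + _](_ : _ = limn (series (k *: (fun j => a i j * z i j)))).
  rewrite -lim_seriesD//; last exact: is_cvg_seriesZ.
  congr (limn (series _)); apply/funext => j.
  transitivity (k * (a i j * z i j) + a i j * w i j) => //.
  by rewrite ell1_addE ell1_scaleE mulrDr mulrCA.
by rewrite lim_seriesZ.
Qed.

Lemma ell1_pairing_le (a : 'I_n -> nat -> R) (M : R) z :
  (forall i j, `|a i j| <= M) -> `|ell1_pairing a z| <= M * `|z|.
Proof.
move=> aM; rewrite ell1_normE mulr_sumr (le_trans (ler_norm_sum _ _ _))//.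
apply: ler_sum => i _; have zc := @ell1_pairing_cvg _ _ z i aM.
rewrite -(cvg_lim _ (cvg_norm zc))//.
apply: limr_le; first exact: is_cvg_norm.
apply: nearW => N; have M0 : 0 <= M by exact: le_trans (aM i 0%N).
rewrite (le_trans _ (ler_wpM2l M0 (ell1_row_ge z i N)))//.
rewrite !seriesEnat/= mulr_sumr (le_trans (ler_norm_sum _ _ _))//.
by apply: ler_sum => j _; rewrite normrM ler_wpM2r.
Qed.

End Ell1.

(** * The dual of C(Omega) *)

Section COmegaDual.
Context (R : realType) (n : nat).
Implicit Types (g : C_Omega R n) (i : 'I_n) (j N : nat).

Lemma C_Omega_sumE (I : Type) (r : seq I) (F : I -> C_Omega R n) t :
  (\sum_(k <- r) F k) t = \sum_(k <- r) F k t.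
Proof. by elim/big_rec2: _ => // k _ z _ <-. Qed.

Lemma exists_point_mass i j : exists d : C_Omega R n,
  forall i' j', d (Omega_pt R i' j') = ((i' == i) && (j' == j))%:R.
Proof.
have [i'|d [dpt _]] := @exists_C_Omega R n (ell1_basis R i j) (fun=> 0).
  apply: cvg_near_cst; exists j.+1 => // k /= jk.
  by rewrite /ell1_delta gtn_eqF// andbF.
by exists d.
Qed.

Lemma exists_row_indicator i : exists d : C_Omega R n,
  forall i' j', d (Omega_pt R i' j') = (i' == i)%:R.
Proof.
have [i'|d [dpt _]] := @exists_C_Omega R n (fun i' _ => (i' == i)%:R)
  (fun i' => (i' == i)%:R); first exact: cvg_cst.
by exists d.
Qed.

Lemma C_Omega_approx g (e : R) : 0 < e -> \forall N \near \oo,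
  forall i j, (N <= j)%N -> `|g (Omega_limit R i) - g (Omega_pt R i j)| <= e.
Proof.
move=> e0; apply: filter_forall => i.
have /cvgrPdist_le/(_ _ e0)[N _ gN] := @C_Omega_cvg R n g i.
by exists N => // k /= Nk j kj; apply: gN; exact: leq_trans kj.
Qed.

(** With [d] the point masses and [r] the row indicators, the weights are [z i j = f (d (i, j))] and
    [c i = f (r i)] minus the sum of row [i] of [z], because a row indicator also sees all isolated
    points of its row. *)
Lemma C_Omega_dual (f : {linear C_Omega R n -> R^o}) : continuous f ->
  exists (c : 'I_n -> R) (z : ell1 R n), forall g,
    f g = \sum_(i < n) c i * g (Omega_limit R i) +
          ell1_pairing (fun i j => g (Omega_pt R i j)) z.
Proof.
move=> fc.
have [C C0 fC] : exists2 C : R, 0 < C & forall g, `|f g| <= C * `|g|.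
  have /linear_bounded_continuous/linear_boundedP := fc.
  by move=> /pinfty_ex_gt0[C C0 fC]; exists C.
have /choice[d dpt] (p : 'I_n * nat) := exists_point_mass p.1 p.2.
have /choice[r rpt] := exists_row_indicator.
have dsum (u : nat -> R) N i i' j :
    (\sum_(0 <= l < N) u l *: d (i, l)) (Omega_pt R i' j) =
    if (i' == i) && (j < N)%N then u j else 0.
  rewrite C_Omega_sumE.
  transitivity (\sum_(0 <= l < N) u l * ((i' == i) && (j == l))%:R).
    by apply: eq_bigr => l _; rewrite -[LHS]/(u l * d (i, l) _) dpt.
  case: eqP => _ /=; first by rewrite sum_eq_index.
  by rewrite big1// => l _; rewrite mulr0.
(* The row sum is the value of [f] at a combination of point masses with sign coefficients, whose
   sup norm is at most 1; hence the bound [C]. *)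
have fsum N i : series (fun j => `|f (d (i, j))|) N <= C.
  have -> : series (fun j => `|f (d (i, j))|) N =
      f (\sum_(0 <= j < N) Num.sg (f (d (i, j)) : R) *: d (i, j)).
    rewrite seriesEnat/= linear_sum; apply: eq_bigr => j _.
    by rewrite linearZ/= [LHS]normrEsg.
  rewrite (le_trans (ler_norm _))// (le_trans (fC _))// ler_piMr ?(ltW C0)//.
  apply: C_Omega_norm_le => // i' j; rewrite dsum.
  case: ifP => _; last by rewrite normr0.
  by rewrite normr_sg lern1 leq_b1.
have zP : abs_summable (fun i j => f (d (i, j))).
  apply/asboolP => i; apply: nondecreasing_is_cvgn.
    exact: nondecreasing_series.
  by exists C => _ [N _ <-]; exact: fsum.
pose z := Ell1 zP.
pose s i := limn (series (z i)).
have scvg i : series (z i) @ \oo --> s i.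
  exact: (normed_cvg (@ell1_cvg _ _ z i)).
exists (fun i => f (r i) - s i), z => g.
pose gl i := g (Omega_limit R i).
pose gp i j := g (Omega_pt R i j).
(* [h N] agrees with [g] on the first [N] columns and continues each row by its limit value; it
   converges uniformly to [g]. *)
pose h N := \sum_(i < n) (gl i *: r i +
  \sum_(0 <= j < N) (gp i j - gl i) *: d (i, j)).
have hE N i j : h N (Omega_pt R i j) = if (j < N)%N then gp i j else gl i.
  have termE k : (gl k *: r k + \sum_(0 <= j < N) (gp k j - gl k) *: d (k, j))
      (Omega_pt R i j) =
    gl k * (i == k)%:R + if (i == k) && (j < N)%N then gp k j - gl k else 0.
    by rewrite -(dsum (fun j => gp k j - gl k)) -(rpt k i j).
  rewrite /h C_Omega_sumE; under eq_bigr do rewrite termE.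
  rewrite (bigD1 i)//= big1 ?addr0 => [|k ki].
    by rewrite eqxx mulr1/=; case: ifP => _; rewrite ?addr0// addrC subrK.
  by rewrite eq_sym (negbTE ki) mulr0/= addr0.
have hg : h N @[N --> \oo] --> g.
  apply/cvgrPdist_le => e e0.
  apply: filterS (C_Omega_approx g e0) => N gN.
  apply: C_Omega_norm_le; first exact: ltW.
  move=> i j; rewrite -[X in `|X|]/(g _ - h N _) hE.
  case: ltnP => jN; first by rewrite subrr normr0 ltW.
  by rewrite distrC; exact: gN.
have fhg : f (h N) @[N --> \oo] --> f g by exact: (continuous_cvg _ (fc g) hg).
have [M gM] : exists M : R, forall i j, `|gp i j| <= M.
  by exists `|g| => i j; exact: Cspace_norm_ge.
rewrite -(cvg_lim _ fhg)// -big_split/=; apply: cvg_lim => //.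
under eq_fun do rewrite linear_sum.
apply: cvg_big => [|i _]; first exact: add_continuous.
rewrite [X in X @ _](_ : _ = fun N => gl i * f (r i) +
    (series (fun j => gp i j * z i j) N - gl i * series (z i) N)); last first.
  apply/funext => N; rewrite linearD linearZ/=; congr (_ + _).
  rewrite linear_sum !seriesEnat/= mulr_sumr -sumrB; apply: eq_bigr => j _.
  by rewrite linearZ/= -mulrBl.
rewrite [X in _ --> X](_ : _ = gl i * f (r i) +
    (limn (series (fun j => gp i j * z i j)) - gl i * s i)); last first.
  by rewrite mulrBl addrA addrAC; congr (_ - _ + _); rewrite mulrC.
apply: cvgD; first exact: cvg_cst.
apply: cvgB; first exact: (@ell1_pairing_cvg _ _ _ _ z i gM).
by apply: cvgMl_tmp; exact: scvg.
Qed.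

End COmegaDual.

(** * Norming functionals, annihilators and weak-star limits *)

Section DualNorm.
Context (R : realType) (X : normedModType R).
Implicit Types (f : dual X) (u : X).

Lemma dual_normE f : `|f| = sup [set `|f u| | u in [set u : X | `|u| <= 1]].
Proof. by []. Qed.

Lemma dual_apply_le f u : `|f u| <= `|f| * `|u|.
Proof.
have fub : has_ubound [set `|f u| | u in [set u : X | `|u| <= 1]].
  have /linear_bounded_continuous/linear_boundedP : continuous (dual_fun f).
    exact: (@dual_continuous _ _ f).
  move=> /pinfty_ex_gt0[M M0 fM]; exists M => _ [v /= v1 <-].
  by rewrite (le_trans (fM v))// -[leRHS]mulr1 ler_pM2l.
have [->|u0] := eqVneq u 0; first by rewrite linear0 !normr0 mulr0.
rewrite -ler_pdivrMr ?normr_gt0// mulrC.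
have -> : `|u|^-1 * `|f u| = `|f (`|u|^-1 *: u)|.
  by rewrite linearZ [RHS]normrM normfV normr_id.
rewrite dual_normE; apply: ub_le_sup => //; exists (`|u|^-1 *: u) => //=.
by rewrite normrZ normfV normr_id mulVf// normr_eq0.
Qed.

Lemma exists_norming_functional u : exists f : dual X, `|f| <= 1 /\ f u = `|u|.
Proof.
have [f [fle fu]] := Hahn_Banach u (normr_sublinear X).
have fn v : `|f v| <= 1 * `|v|.
  (* Applying the one-sided bound at [- v] as well turns it into a bound on the absolute value. *)
  by rewrite mul1r ler_norml fle andbT -normrN lerNl -linearN fle.
have fdual : is_dual (f : X -> R^o).
  apply/asboolP; split; first exact: linearP.
  exact: linear_bound_continuous fn.
exists (Dual fdual); split => //.
rewrite dual_normE; apply: ge_sup => [|_ [v /= v1 <-]].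
  by exists `|f 0|, 0 => //=; rewrite normr0.
by rewrite (le_trans (fn v))// mul1r.
Qed.

End DualNorm.

(** Hahn-Banach for the distance to the range: [f] is at most 0 on the range, which is stable under
    negation, so it vanishes there. The distance is at most the norm, which gives continuity. *)
Lemma exists_annihilator (R : realType) (U : lmodType R) (V : normedModType R)
    (T : {linear U -> V}) (v : V) :
  exists f : {linear V -> R^o},
    [/\ continuous f, forall u, f (T u) = 0 & f v = dist_range T v].
Proof.
have [f [fle fv]] := Hahn_Banach v (dist_range_sublinear T).
have dist_norm w : dist_range T w <= `|w|.
  by rewrite (le_trans (dist_range_le T 0 w))// linear0 subr0.
have fT_le0 u : f (T u) <= 0.
  rewrite (le_trans (fle _))// (le_trans (dist_range_le T u _))//.
  by rewrite subrr normr0.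
exists f; split => //.
  apply: (@linear_bound_continuous _ _ _ _ 1) => w; rewrite mul1r ler_norml.
  rewrite (le_trans (fle w))// andbT -normrN lerNl -linearN.
  by rewrite (le_trans (fle _)).
move=> u; apply/eqP; rewrite eq_le fT_le0/=.
by rewrite -oppr_le0 -!linearN.
Qed.

(** The initial topology makes the map to the pointwise topology continuous, and convergence there
    is convergence at each [v]. *)
Lemma weak_star_cvg_apply (R : realType) (E X : normedModType R)
    (Phi : E -> dual X) (u : nat -> E) (l : E) (v : X) :
  weak_star_cvg Phi u l -> Phi (u j) v @[j --> \oo] --> Phi l v.
Proof.
move=> ul.
have : (fun j => (Phi (u j) : X -> R^o) : {ptws X -> R^o}) @ \oo -->
    ((Phi l : X -> R^o) : {ptws X -> R^o}).
  move=> A lA; apply: (ul ((fun z => (Phi z : X -> R^o)) @^-1` A)).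
  exact: (@initial_continuous _ {ptws X -> R^o}
    (fun z : E => (Phi z : X -> R^o)) l A lA).
by move=> /pointwise_cvgP/(_ v).
Qed.

Theorem corollary2p2 (R : realType) (n : nat) (n_ge1 : (1 <= n)%N)
    (X : completeNormedModType R)
    (Phi : {linear ell1 R n -> dual X})
    (PhiP : linear_isometry_onto Phi [set: dual X])
    (x : 'I_n -> ell1 R n)
    (x_lim : forall s : 'I_n, weak_star_cvg Phi (ell1_basis R s) (x s)) :
  exists T : {linear X -> C_Omega R n}, linear_isometry_onto T (W_subspace x).
Proof.
have [Phi_iso Phi_range] := PhiP.
have /choice[T0 T0P] u : exists g : C_Omega R n,
    (forall i j, g (Omega_pt R i j) = Phi (ell1_basis R i j) u) /\
    (forall i, g (Omega_limit R i) = Phi (x i) u).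
  by apply: exists_C_Omega => i; exact: weak_star_cvg_apply (x_lim i).
have Tpt u i j : T0 u (Omega_pt R i j) = Phi (ell1_basis R i j) u.
  exact: (T0P u).1.
have Tlim u i : T0 u (Omega_limit R i) = Phi (x i) u by exact: (T0P u).2.
(* Values at the isolated points determine a continuous function, so linearity needs checking only
   there. *)
have T0_linear : linear T0.
  move=> k u v; apply: C_Omega_ext => i j.
  by rewrite -[RHS]/(k *: T0 u _ + T0 v _) !Tpt linearP.
pose T : {linear X -> C_Omega R n} := HB.pack T0
  (GRing.isLinear.Build _ _ _ _ _ T0_linear).
have PhiE w u : Phi w u = ell1_pairing (fun i j => T u (Omega_pt R i j)) w.
  have ev_linear : linear (fun w => Phi w u : R^o).
    by move=> k z w'; rewrite linearP.
  pose ev : {linear ell1 R n -> R^o} := HB.pack (fun w => Phi w u : R^o)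
    (GRing.isLinear.Build _ _ _ _ _ ev_linear).
  rewrite -[LHS]/(ev w) ell1_linear_pairing.
    congr ell1_pairing; apply/funext => i; apply/funext => j.
    by rewrite [RHS]Tpt.
  apply: (@linear_bound_continuous _ _ _ _ `|u|) => z.
  by rewrite mulrC -Phi_iso dual_apply_le.
have T_iso u : `|T u| = `|u|.
  apply/eqP; rewrite eq_le; apply/andP; split.
    apply: C_Omega_norm_le => // i j; rewrite [X in `|X|]Tpt.
    rewrite (le_trans (dual_apply_le _ _))// Phi_iso ler_piMl//.
    exact: ell1_basis_norm_le.
  (* For the lower bound, a norming functional [h] of [u] is some [Phi w] by surjectivity, with [w]
     of norm at most 1; the pairing formula then bounds [h u] by the norm of [T u]. *)
  have [h [h1 hu]] := exists_norming_functional u.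
  have [w _ wh] : range Phi h by rewrite Phi_range.
  rewrite -hu -wh PhiE (le_trans (ler_norm _))//.
  have Tu i j : `|T u (Omega_pt R i j)| <= `|T u| by exact: Cspace_norm_ge.
  rewrite (le_trans (ell1_pairing_le w Tu))// ler_piMr//.
  by rewrite -Phi_iso wh.
exists T; split => //; apply/seteqP; split => [_ [u _ <-] s|g gW].
  by rewrite [LHS]Tlim PhiE.
apply: isometry_range_closed => //.
(* Since [f g] is the distance from [g] to the range, it remains to show that [f g] is 0. *)
have [f [fc fT <-]] := exists_annihilator T g.
have [c [z fE]] := C_Omega_dual fc.
pose w := z + \sum_(i < n) c i *: x i.
have fW h : W_subspace x h ->
    f h = ell1_pairing (fun i j => h (Omega_pt R i j)) w.
  move=> hW.
  have hle i j : `|h (Omega_pt R i j)| <= `|h| by exact: Cspace_norm_ge.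
  pose P : {linear ell1 R n -> R^o} := HB.pack
    (ell1_pairing (fun i j => h (Omega_pt R i j)) : ell1 R n -> R^o)
    (GRing.isLinear.Build _ _ _ _ _ (ell1_pairing_linear hle)).
  rewrite fE -[RHS]/(P w) linearD linear_sum addrC; congr (_ + _).
  by apply: eq_bigr => i _; rewrite linearZ hW.
(* Each [T u] lies in W, so [Phi w u = f (T u) = 0] for all [u]; injectivity of the isometry [Phi]
   gives [w = 0]. *)
have w0 : w = 0.
  apply/eqP; rewrite -normr_eq0 -Phi_iso normr_eq0.
  apply/eqP/val_inj/funext => u.
  rewrite -[LHS]/(Phi w u) PhiE -fW; first exact: fT.
  by move=> s; rewrite [LHS]Tlim PhiE.
have gle i j : `|g (Omega_pt R i j)| <= `|g| by exact: Cspace_norm_ge.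
rewrite fW// w0; apply/eqP; rewrite -normr_le0.
by rewrite (le_trans (ell1_pairing_le 0 gle))// normr0 mulr0.
Qed.
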